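(* Let $p_{22},p_{21},p_{20},q_{11},q_{10},q_{22},q_{21},q_{20},\beta,\gamma$ be real constants, put $p_2(x)=p_{22}x^2+p_{21}x+p_{20}$, and consider the planar quadratic polynomial differential system $$\dot x=p_2(x),\qquad \dot y=y^2+(q_{11}x+q_{10})y+q_{22}x^2+q_{21}x+q_{20}. \qquad (S)$$ Put $r(x)=(2p_{22}+q_{11}-2\beta)x+p_{21}+q_{10}-2\gamma$ and write $r(x)=\tau_{11}x+\tau_{10}$. Let $\kappa=\tau_0$ be a nonzero constant and let $a_0=a_0(x)$ be a nonzero polynomial solution of $$p_2(x)a_0''+r(x)a_0'+\kappa a_0=0 .$$ Then the most general system of the form $(S)$ which admits the invariant algebraic curve $$a_0\bigl(y-\bigl((\beta-q_{11})x+\gamma-q_{10}\bigr)\bigr)+p_2a_0'=0$$ with cofactor $K=y+\beta x+\gamma$ is $$\begin{aligned} \dot x={}&p_{22}x^2+p_{21}x+p_{20},\\ \dot y={}&y^2+(2\beta-2p_{22}+\tau_{11})xy+(2\gamma+\tau_{10}-p_{21})y\\ &+\bigl(2p_{22}^2-(\tau_{11}-\tau_0+3\beta)p_{22}+\beta^2+\beta\tau_{11}\bigr)x^2\\ &+\bigl(2p_{22}p_{21}-(2\beta-\tau_0+\tau_{11})p_{21}+\gamma(\tau_{11}-2p_{22}+2\beta)+\beta\tau_{10}\bigr)x\\ &+p_{20}(2p_{22}-\tau_{11}+\tau_0-\beta)+\gamma(\gamma+\tau_{10}-p_{21}); \end{aligned}$$ that is, the curve is invariant for $(S)$ with cofactor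 $y+\beta x+\gamma$ if and only if $(S)$ is this system.
   Context: For a polynomial vector field $\mathcal X=P\,\partial_x+Q\,\partial_y$ associated with $\dot x=P(x,y)$, $\dot y=Q(x,y)$, of degree $m=\max\{\deg P,\deg Q\}$, and a polynomial $g(x,y)$, the curve $g=0$ is an invariant algebraic curve of $\mathcal X$ with cofactor $K$ if $P\,\partial g/\partial x+Q\,\partial g/\partial y=Kg$, where $K=K(x,y)$ is a polynomial of degree at most $m-1$. Primes denote derivatives with respect to $x$. *)

(* Defs.v *)
From mathcomp Require Export all_boot all_order all_algebra.
From mathcomp Require Export reals.
From mathcomp Require Export mpoly.

Set Implicit Arguments.
Unset Strict Implicit.
Unset Printing Implicit Defensive.

Import GRing.Theory.
Local Open Scope ring_scope.

(* In [{mpoly R[2]}], the variable x has index 0 and y has index 1. *)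
Notation xvar R := ('X_(0 : 'I_2) : {mpoly R[2]}) (only parsing).
Notation yvar R := ('X_(1 : 'I_2) : {mpoly R[2]}) (only parsing).

Definition of_x (R : realType) (f : {poly R}) : {mpoly R[2]} :=
  (map_poly (@mpolyC 2 R) f).[xvar R].

Record vector_field (R : realType) : Type := VectorField {
  vfP : {mpoly R[2]};
  vfQ : {mpoly R[2]}
}.

(* [msize] is 1 + total degree (0 for the zero polynomial). *)
Definition vf_degree (R : realType) (V : vector_field R) : nat :=
  maxn (msize (vfP V)).-1 (msize (vfQ V)).-1.

(* [msize K <= m] says deg K <= m - 1, the zero cofactor being allowed. *)
Definition invariant_curve_with_cofactor (R : realType) (V : vector_field R)
    (g K : {mpoly R[2]}) : Prop :=
  vfP V * mderiv (0 : 'I_2) g + vfQ V * mderiv (1 : 'I_2) g = K * g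
  /\ (msize K <= vf_degree V)%N.

Definition quadratic_poly (R : realType) (c2 c1 c0 : R) : {poly R} :=
  c2 *: 'X^2 + c1 *: 'X + c0%:P.

Definition system_S (R : realType) (p22 p21 p20 q11 q10 q22 q21 q20 : R) :
    vector_field R :=
  {| vfP := of_x (quadratic_poly p22 p21 p20);
     vfQ := (yvar R) ^+ 2 + of_x (q11 *: 'X + q10%:P) * yvar R
            + of_x (quadratic_poly q22 q21 q20) |}.

(* Main.v *)
From HB Require Import structures.
Require Import Defs.
From mathcomp Require Import ring.
Import GRing.Theory.
Local Open Scope ring_scope.

(** Put [k = beta x + gamma], [l = (beta - q11) x + gamma - q10] and let [q] be
    the part of the second component of the system that does not involve [y],
    so that this component is [y^2 + (k - l) y + q].  For the curve
    [g = a0 (y - l) + p2 a0'] and the cofactor [K = y + k], the expression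
    [P g_x + Q g_y - K g] is a priori quadratic in [y], but the choice of [l]
    makes the coefficients of [y^2] and [y] vanish identically.  What remains
    ([curve_defect]) is the polynomial in [x]

      [p2 (p2 a0'' + (p2' - l - k) a0') + a0 (q - p2 l' + k l)].

    Here [p2' - l - k] is exactly [r], so the differential equation of [a0]
    replaces the first bracket by [- tau0 a0], and the defect becomes
    [a0 (q - (p2 (l' + tau0) - k l))].  Since [a0] is nonzero and univariate
    polynomials embed in [{mpoly R[2]}] ([of_x_inj]), the curve is invariant
    exactly when [q = p2 (l' + tau0) - k l]; expanding this quadratic, with
    [q11] and [q10] expressed through [r], gives the announced coefficients.

    The bound on the degree of the cofactor always holds: [K] has degree at
    most 1, and the term [y^2] forces the system to have degree at least 2. *)

Lemma of_x_is_nmod_morphism (R : realType) : nmod_morphism (@of_x R).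
Proof.
by split=> [|p q]; rewrite /of_x (rmorph0, rmorphD) (horner0, hornerD).
Qed.

Lemma of_x_is_monoid_morphism (R : realType) : monoid_morphism (@of_x R).
Proof.
by split=> [|p q]; rewrite /of_x (rmorph1, rmorphM) (hornerC, hornerM).
Qed.

HB.instance Definition _ (R : realType) :=
  GRing.isNmodMorphism.Build {poly R} {mpoly R[2]} (@of_x R)
    (of_x_is_nmod_morphism R).
HB.instance Definition _ (R : realType) :=
  GRing.isMonoidMorphism.Build {poly R} {mpoly R[2]} (@of_x R)
    (of_x_is_monoid_morphism R).

Lemma of_xC (R : realType) (c : R) : of_x c%:P = c%:MP_[2].
Proof. by rewrite /of_x map_polyC hornerC. Qed.

Lemma of_xX (R : realType) : of_x 'X = xvar R.
Proof. by rewrite /of_x map_polyX hornerX. Qed.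

(** The left inverse is the evaluation at [(x, y) = ('X, 0)]. *)
Lemma of_x_inj (R : realType) : injective (@of_x R).
Proof.
pose var (i : 'I_2) : {poly R} := if i == 0 then 'X else 0.
apply: (can_inj (g := mmap (@polyC R) var)) => p.
elim/poly_ind: p => [|p c IHp]; first by rewrite rmorph0 mmap0.
rewrite rmorphD rmorphM /= of_xC of_xX mmapD mmapC.
by rewrite rmorphM /= IHp mmapX mmap1U /var eqxx.
Qed.

Lemma mderiv_var (n : nat) (A : nzRingType) (i j : 'I_n) :
  mderiv i 'X_j = (j == i)%:R :> {mpoly A[n]}.
Proof.
rewrite mderivX mnm1E; case: eqP => [->|_]; last by rewrite scale0r.
by rewrite scale1r -{1}[U_(i)%MM]add0m addmK mpolyX0.
Qed.

Lemma mderiv_x_of_x (R : realType) (p : {poly R}) :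
  mderiv (0 : 'I_2) (of_x p) = of_x p^`().
Proof.
elim/poly_ind: p => [|p c IHp]; first by rewrite deriv0 rmorph0 mderiv0.
rewrite derivD derivM derivX derivC addr0 mulr1.
rewrite !rmorphD !rmorphM /= of_xC of_xX mderivD mderivM mderivC addr0 IHp.
by rewrite mderiv_var mulr1.
Qed.

Lemma mderiv_y_of_x (R : realType) (p : {poly R}) :
  mderiv (1 : 'I_2) (of_x p) = 0.
Proof.
elim/poly_ind: p => [|p c IHp]; first by rewrite rmorph0 mderiv0.
rewrite rmorphD rmorphM /= of_xC of_xX mderivD mderivM mderivC addr0 IHp.
by rewrite mderiv_var mulr0 mul0r addr0.
Qed.

(** The defect of invariance involves no [y] because the coefficient of [y] in
    the field is tied to the cofactor and to the curve as [k - l]. *)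
Lemma curve_defect (R : realType) (p q k l a : {poly R}) :
  let g := of_x a * (yvar R - of_x l) + of_x p * of_x a^`() in
  of_x p * mderiv (0 : 'I_2) g
    + ((yvar R) ^+ 2 + of_x (k - l) * yvar R + of_x q) * mderiv (1 : 'I_2) g
    - (yvar R + of_x k) * g
  = of_x (p * (p * a^`(2) + (p^`() - l - k) * a^`())
            + a * (q - p * l^`() + k * l)).
Proof.
rewrite /= !(mderivD, mderivM, mderivN).
rewrite !(mderiv_x_of_x, mderiv_y_of_x, mderiv_var).
rewrite !(rmorphD, rmorphN, rmorphM) /=.
ring.
Qed.

Lemma msize_of_x_linear (R : realType) (b c : R) :
  (msize (of_x (b *: 'X + c%:P)) <= 2)%N.
Proof.
rewrite -mul_polyC rmorphD rmorphM /= !of_xC of_xX mul_mpolyC.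
apply: leq_trans (msizeD_le _ _) _; rewrite geq_max msizeC.
by rewrite (leq_trans (msizeZ_le _ _)) ?msizeX ?mdeg1 //; case: (c != 0).
Qed.

(** Differentiating twice in [y] leaves the constant 2 whatever the parameters
    are, so the monomial [y^2] occurs in the second component. *)
Lemma vf_degree_system_S (R : realType) (p22 p21 p20 q11 q10 q22 q21 q20 : R) :
  (2 <= vf_degree (system_S p22 p21 p20 q11 q10 q22 q21 q20))%N.
Proof.
apply: leq_trans (leq_maxr _ _); rewrite /=; set Q := (X in msize X).
suff: (U_(1) + U_(1))%MM \in msupp Q.
  by move=> /msize_mdeg_lt; rewrite mdegD !mdeg1; case: (msize Q).
have: Q^`M(1)^`M(1) = 2%:R%:MP_[2].
  rewrite /Q expr2 !(mderivD, mderivM, mderiv_y_of_x, mderiv_var) eqxx.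
  have d1 : (1 : {mpoly R[2]})^`M(1) = 0 by rewrite -mpolyC1 mderivC.
  by rewrite [true%:R]/(1 : {mpoly R[2]}) !d1 mderiv0 rmorph_nat; ring.
move=> /(congr1 (mcoeff 0%MM)).
rewrite !mcoeff_mderiv mcoeffC eqxx mulr1 add0m => Q2E.
apply: contraT; rewrite -mcoeff_eq0 => /eqP Q0; move/eqP: Q2E.
by rewrite Q0 !mul0rn eq_sym Num.Theory.pnatr_eq0.
Qed.

Lemma quadratic_poly_inj (R : realType) (c2 c1 c0 d2 d1 d0 : R) :
  quadratic_poly c2 c1 c0 = quadratic_poly d2 d1 d0 ->
  [/\ c2 = d2, c1 = d1 & c0 = d0].
Proof.
move=> /polyP E; split; [move: (E 2%N)|move: (E 1%N)|move: (E 0%N)];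
by rewrite /quadratic_poly !coefE /= !(mulr0, mulr1, add0r, addr0).
Qed.

Theorem theorem3 (R : realType)
  (p22 p21 p20 q11 q10 q22 q21 q20 beta gamma : R)
  (tau11 tau10 tau0 : R) (a0 : {poly R}) :
  let p2 : {poly R} := quadratic_poly p22 p21 p20 in
  let r : {poly R} :=
    (2 * p22 + q11 - 2 * beta) *: 'X + (p21 + q10 - 2 * gamma)%:P in
  r = tau11 *: 'X + tau10%:P ->
  tau0 != 0 ->
  a0 != 0 ->
  p2 * a0^`(2) + r * a0^`() + tau0 *: a0 = 0 ->
  invariant_curve_with_cofactor
    (system_S p22 p21 p20 q11 q10 q22 q21 q20)
    (of_x a0 * (yvar R - of_x ((beta - q11) *: 'X + (gamma - q10)%:P))
       + of_x p2 * of_x a0^`())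
    (yvar R + of_x (beta *: 'X + gamma%:P))
  <->
  system_S p22 p21 p20 q11 q10 q22 q21 q20 =
  system_S p22 p21 p20
    (2 * beta - 2 * p22 + tau11)
    (2 * gamma + tau10 - p21)
    (2 * p22 ^+ 2 - (tau11 - tau0 + 3 * beta) * p22
       + beta ^+ 2 + beta * tau11)
    (2 * p22 * p21 - (2 * beta - tau0 + tau11) * p21
       + gamma * (tau11 - 2 * p22 + 2 * beta) + beta * tau10)
    (p20 * (2 * p22 - tau11 + tau0 - beta)
       + gamma * (gamma + tau10 - p21)).
Proof.
move=> p2 r r_tau _ a0_neq0 ode.
have [tau11E tau10E] :
    tau11 = 2 * p22 + q11 - 2 * beta /\ tau10 = p21 + q10 - 2 * gamma.
  by split; [move/polyP/(_ 1%N): r_tau | move/polyP/(_ 0%N): r_tau];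
     rewrite /r !coefE /= !(mulr0, mulr1, add0r, addr0).
(* With [tau11] and [tau10] eliminated, both systems have the same [xy] and
   [y] coefficients, and only [q] is at stake. *)
rewrite {r_tau}tau11E {}tau10E.
have -> : 2 * beta - 2 * p22 + (2 * p22 + q11 - 2 * beta) = q11 by ring.
have -> : 2 * gamma + (p21 + q10 - 2 * gamma) - p21 = q10 by ring.
set c2 := (X in _ = system_S _ _ _ _ _ X _ _).
set c1 := (X in _ = system_S _ _ _ _ _ _ X _).
set c0 := (X in _ = system_S _ _ _ _ _ _ _ X).
pose k : {poly R} := beta *: 'X + gamma%:P.
pose l : {poly R} := (beta - q11) *: 'X + (gamma - q10)%:P.
pose q := quadratic_poly q22 q21 q20.
have q1E : q11 *: 'X + q10%:P = k - l.
  by rewrite /k /l -!mul_polyC !(polyCB, polyCD); ring.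
have p2' : p2^`() = (2 * p22) *: 'X + p21%:P.
  rewrite /p2 /quadratic_poly !derivE -!mul_polyC !(polyCM, polyCD).
  by ring.
have l' : l^`() = (beta - q11)%:P.
  by rewrite /l !derivE -!mul_polyC; ring.
have rE : r = p2^`() - l - k.
  by rewrite p2' /r /l /k -!mul_polyC !(polyCB, polyCD, polyCM); ring.
(* The value of [q] forced by invariance. *)
have cE : quadratic_poly c2 c1 c0 = p2 * (l^`() + tau0%:P) - k * l.
  rewrite l' /c2 /c1 /c0 /p2 /k /l /quadratic_poly -!mul_polyC.
  rewrite !(polyCB, polyCD, polyCM, rmorphXn, rmorph_nat).
  by ring.
have defectE : p2 * (p2 * a0^`(2) + (p2^`() - l - k) * a0^`())
    + a0 * (q - p2 * l^`() + k * l) = a0 * (q - quadratic_poly c2 c1 c0).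
  rewrite -rE cE; move/eqP: ode; rewrite addr_eq0 => /eqP ->.
  by rewrite -mul_polyC; ring.
have := curve_defect _ p2 q k l a0; rewrite /= defectE -q1E.
rewrite /invariant_curve_with_cofactor /= => defect; split.
- case=> /eqP; rewrite -subr_eq0 defect => /eqP.
  rewrite -(rmorph0 (@of_x R)) => /of_x_inj /eqP.
  rewrite mulf_eq0 (negbTE a0_neq0) subr_eq0 => /eqP /quadratic_poly_inj.
  by case=> <- <- <-.
- move=> /(congr1 (@vfQ R)) /= /addrI /of_x_inj qE; split.
    by apply/eqP; rewrite -subr_eq0 defect /q qE subrr mulr0 rmorph0.
  apply: leq_trans _ (vf_degree_system_S _ _ _ _ _ _ _ _ _).
  apply: leq_trans (msizeD_le _ _) _.
  by rewrite geq_max msizeX mdeg1 msize_of_x_linear.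
Qed.
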